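(* Let ${\mathbb K}$ be a field, $n\geqslant 2$ and $N$ a positive integer. Let $L$ be a set of lines of $\mathrm{AG}_n({\mathbb K})$, let $D\subseteq\mathrm{PG}_{n-1}({\mathbb K})$ be the set of directions of the lines of $L$, and let $S$ be a set of points of $\mathrm{AG}_n({\mathbb K})$ such that every line of $L$ is incident with at least $N$ points of $S$. If $D$ contains an $N^{n-1}$ grid then $|S|\geqslant(\frac{1}{2}N)^n$.
   Context: The direction of an affine line $\{u+\lambda v:\lambda\in{\mathbb K}\}$ is the point $\langle v\rangle$ of $\mathrm{PG}_{n-1}({\mathbb K})$. An $N^{n-1}$ grid in $\mathrm{PG}_{n-1}({\mathbb K})$ is a point set which, with respect to a suitable basis, has the form $\{\langle(a_1,\ldots,a_{n-1},1)\rangle : a_i\in A_i\}$, where each $A_i\subseteq{\mathbb K}$ has size $N$. *)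

(* Defs.v *)
From HB Require Import structures.
From mathcomp Require Import all_boot all_order all_algebra.
Set Implicit Arguments. Unset Strict Implicit. Unset Printing Implicit Defensive.
Import Order.TTheory GRing.Theory Num.Theory.
Local Open Scope ring_scope.

(* Points of AG_n(K) are row vectors 'rV[K]_n.
   An affine line is given by a pair (u, v) with v != 0; its point set is
   { u + lam *: v | lam in K }. *)
Definition on_line (K : fieldType) (n : nat) (u v x : 'rV[K]_n) : Prop :=
  exists lam : K, x = u + lam *: v.

(* <v> = <w> as points of PG_{n-1}(K) (for nonzero v, w). *)
Definition same_dir (K : fieldType) (n : nat) (v w : 'rV[K]_n) : Prop :=
  exists c : K, c != 0 /\ v = c *: w.

Definition grid_vec (K : fieldType) (n : nat) (a : 'I_n.-1 -> K) : 'rV[K]_n :=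
  \row_(i < n) oapp a 1 (insub (val i) : option 'I_n.-1).

(* D (given as a predicate on projective points, represented by vectors up
   to nonzero scalars) contains an N^(n-1) grid: for a basis given by the rows
   of the invertible matrix B and sets A_1..A_{n-1} of size N, every point
   <sum_i a_i b_i + b_n> with a_i in A_i lies in D. *)
Definition contains_grid (K : fieldType) (n N : nat) (D : 'rV[K]_n -> Prop) : Prop :=
  exists (B : 'M[K]_n) (A : 'I_n.-1 -> seq K),
    B \in unitmx /\
    (forall j, uniq (A j) /\ size (A j) = N) /\
    (forall a : 'I_n.-1 -> K, (forall j, a j \in A j) -> D (grid_vec a *m B)).

Definition directions (K : fieldType) (n : nat) (L : 'rV[K]_n -> 'rV[K]_n -> Prop)
  (w : 'rV[K]_n) : Prop :=
  exists u v, L u v /\ same_dir v w.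

(* Main.v *)
(* The method of multiplicities. If S is small, a dimension count produces a
   nonzero polynomial P of degree less than l N vanishing at every point of S to
   order about 2 l. Restricting the Hasse derivatives of P of order less than l
   to the lines with at least N points in S shows that the top-degree part of P
   vanishes to order l at all directions, in particular on the grid; as its
   degree is less than l N, it is zero by the Schwartz-Zippel argument with
   multiplicities. Comparing dimensions and letting l tend to infinity gives
   N^n <= 2^n |S|. *)
Require Import Defs.
From HB Require Import structures.
From mathcomp Require Import all_boot all_order all_algebra zify.
Import Order.TTheory GRing.Theory Num.Theory.
Local Open Scope ring_scope.

Set Implicit Arguments. Unset Strict Implicit. Unset Printing Implicit Defensive.

(** * Hasse derivatives and their Taylor expansion *)

Lemma ffactD (a j b : nat) : (a ^_ (j + b) = a ^_ j * (a - j) ^_ b)%N.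
Proof.
elim: b => [|b IHb]; first by rewrite addn0 ffactn0 muln1.
by rewrite addnS !ffactnSr IHb subnDA mulnA.
Qed.

(** Multiplied by [j! b!], both sides become the falling factorial of [a] of length [j + b]. *)
Lemma mul_bin_subset (a j b : nat) :
  ('C(a, j + b) * 'C(j + b, j) = 'C(a, j) * 'C(a - j, b))%N.
Proof.
apply/eqP; rewrite -(@eqn_pmul2r (j`! * b`!)) ?muln_gt0 ?fact_gt0 //.
have := bin_fact (leq_addr b j); rewrite addKn -mulnA => ->.
by rewrite bin_ffact ffactD mulnACA !bin_ffact.
Qed.

Section Hasse.
Variables (n D : nat).
Implicit Types j : 'I_n -> nat.

(* [hasse c j x] is the coefficient of [Y^j] in [P(x + Y)], where
   [P = \sum_a c a X^a]. *)
Definition hasse (R : comNzRingType) (c : {ffun 'I_n -> 'I_D} -> R)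
    (j : 'I_n -> nat) (x : 'I_n -> R) : R :=
  \sum_a c a * \prod_i (x i ^+ (a i - j i) *+ 'C(a i, j i)).

(** Taylor's formula for one monomial. The sum runs to the fixed bound [D] instead of [a - j], so
    that a product over the variables can be distributed; the extra terms have zero binomials. *)
Lemma taylor1 (R : comNzRingType) (x y : R) (a j : nat) : (a < D)%N ->
  (x + y) ^+ (a - j) *+ 'C(a, j) =
  \sum_(b < D) (y ^+ b *+ 'C(j + b, j)) * (x ^+ (a - (j + b)) *+ 'C(a, j + b)).
Proof.
move=> lt_aD; have [lt_aj|le_ja] := ltnP a j.
  rewrite bin_small // mulr0n big1 // => b _.
  by rewrite [in X in _ * X]bin_small ?mulr0n ?mulr0 // ltn_addr.
rewrite exprDn -sumrMnl.
rewrite (big_ord_widen_cond D xpredT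
  (fun i => x ^+ (a - j - i) * y ^+ i *+ 'C(a - j, i) *+ 'C(a, j))); last first.
  by rewrite (leq_trans _ lt_aD) // ltnS leq_subr.
rewrite big_mkcond /=; apply: eq_bigr => b _.
rewrite mulrnAl mulrnAr -!mulrnA mul_bin_subset subnDA mulrC.
case: ltnP => [_|lt_b]; first by rewrite [in LHS]mulnC.
by rewrite (bin_small lt_b) muln0 mulr0n.
Qed.

Lemma taylor (R : comNzRingType) (c : {ffun 'I_n -> 'I_D} -> R) j (x y : 'I_n -> R) :
  hasse c j (fun i => x i + y i) =
  \sum_(b : {ffun 'I_n -> 'I_D}) (\prod_i (y i ^+ b i *+ 'C(j i + b i, j i))) *
    hasse c (fun i => j i + b i)%N x.
Proof.
rewrite /hasse; under [RHS]eq_bigr do rewrite mulr_sumr.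
rewrite exchange_big /=; apply: eq_bigr => a _.
under [in LHS]eq_bigr => i _ do rewrite taylor1 ?ltn_ord //.
rewrite bigA_distr_bigA mulr_sumr; apply: eq_bigr => b _.
by rewrite big_split /= mulrCA.
Qed.

Lemma hasse_ext (R : comNzRingType) (c : {ffun 'I_n -> 'I_D} -> R) j j' (x x' : 'I_n -> R) :
  j =1 j' -> x =1 x' -> hasse c j x = hasse c j' x'.
Proof.
move=> ej ex; apply: eq_bigr => a _; congr (_ * _).
by apply: eq_bigr => i _; rewrite ej ex.
Qed.

Lemma hasse_polyC (R : comNzRingType) (c : {ffun 'I_n -> 'I_D} -> R) j (x : 'I_n -> R) :
  hasse (polyC \o c) j (polyC \o x) = (hasse c j x)%:P.
Proof.
rewrite /hasse rmorph_sum; apply: eq_bigr => a _ /=.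
rewrite rmorphM rmorph_prod; congr (_ * _); apply: eq_bigr => i _ /=.
by rewrite polyCMn polyC_exp.
Qed.
End Hasse.

(** * Univariate polynomials: multiple roots and top coefficients *)

(** Powers of distinct linear factors are coprime, so their product, of degree [size r * e], divides
    [p]. *)
Lemma poly_mult_roots_eq0 (K : fieldType) (p : {poly K}) (r : seq K) (e : nat) :
  uniq r -> (forall a, a \in r -> ('X - a%:P) ^+ e %| p) ->
  (size p <= size r * e)%N -> p = 0.
Proof.
move=> uniq_r dvd_p; apply: contraTeq => p_neq0; rewrite -ltnNge.
have: \prod_(a <- r) ('X - a%:P) ^+ e %| p.
  elim: r uniq_r dvd_p => [|a r IHr] /=; first by rewrite big_nil dvd1p.
  case/andP=> a_notin uniq_r dvd_p; rewrite big_cons Gauss_dvdp.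
    rewrite dvd_p ?mem_head // IHr // => b b_r.
    by rewrite dvd_p // inE b_r orbT.
  rewrite prodrXl; apply: coprimep_expl; apply: coprimep_expr.
  by rewrite coprimep_sym coprimep_XsubC root_prod_XsubC.
rewrite prodrXl => /(dvdp_leq p_neq0); apply: leq_trans.
set q := \prod_(a <- r) _; have := size_exp q e.
rewrite size_prod_XsubC /= => <-; rewrite prednK // lt0n size_poly_eq0.
by rewrite expf_neq0 // monic_neq0 ?monic_prod_XsubC.
Qed.

Lemma hasse_term_eq0 (R : comNzRingType) (n : nat) (x : 'I_n -> R) (a j : 'I_n -> nat) (i : 'I_n) :
  (a i < j i)%N -> \prod_i (x i ^+ (a i - j i) *+ 'C(a i, j i)) = 0.
Proof. by move=> lt_i; rewrite (bigD1 i) //= bin_small // mulr0n mul0r. Qed.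

(** Here [m] only bounds the degree and [w] may be zero, which makes the notion stable under sums
    and products. *)
Definition top_coef (R : comNzRingType) (p : {poly R}) (m : nat) (w : R) :=
  (size p <= m.+1)%N /\ p`_m = w.

Lemma top_coefM (R : comNzRingType) (p q : {poly R}) (m k : nat) (v w : R) :
  top_coef p m v -> top_coef q k w -> top_coef (p * q) (m + k) (v * w).
Proof.
move=> [le_p <-] [le_q <-]; split.
  apply: leq_trans (size_polyMleq _ _) _.
  by rewrite -subn1 leq_subLR add1n -addSn -addnS leq_add.
have lt_m : (m < (m + k).+1)%N by rewrite ltnS leq_addr.
rewrite coefM (bigD1 (Ordinal lt_m)) //= addKn big1 ?addr0 // => i neq_im.
have [lt_im|le_mi] := ltnP i m.
  by rewrite [q`__]nth_default ?mulr0 // (leq_trans le_q) // ltn_subRL ltn_add2r.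
rewrite [X in X * _]nth_default ?mul0r // (leq_trans le_p) // ltn_neqAle le_mi andbT.
by apply: contra neq_im => /eqP eq_mi; apply/eqP/val_inj.
Qed.

Lemma top_coefX (R : comNzRingType) (p : {poly R}) (m k : nat) (w : R) :
  top_coef p m w -> top_coef (p ^+ k) (m * k) (w ^+ k).
Proof.
move=> pw; elim: k => [|k IHk].
  by rewrite muln0 !expr0; split; rewrite ?size_poly1 ?coef1.
by rewrite mulnS !exprS; apply: top_coefM.
Qed.

Lemma top_coef_prod_linear (K : fieldType) (n : nat) (P : pred 'I_n) (u v : 'I_n -> K)
    (k : 'I_n -> nat) :
  (forall i, ~~ P i -> v i = 0) ->
  top_coef (\prod_i ((u i)%:P + v i *: 'X) ^+ k i) (\sum_(i | P i) k i)
    (\prod_i (if P i then v i else u i) ^+ k i).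
Proof.
move=> v0; rewrite [X in top_coef _ X]big_mkcond /=.
apply: (big_ind3 (fun p m w => top_coef p m w)).
- by split; rewrite ?size_poly1 ?coef1.
- by move=> p q m l v1 w; apply: top_coefM.
move=> i _; case: ifP => Pi.
  rewrite -[X in top_coef _ X]mul1n; apply: top_coefX; split.
    apply: leq_trans (size_polyD _ _) _; rewrite geq_max size_polyC.
    rewrite (leq_trans (size_scale_leq _ _)) ?size_polyX // andbT.
    by case: (_ != _).
  by rewrite coefD coefC coefZ coefX mulr1 add0r.
rewrite v0 ?Pi // scale0r addr0 -polyC_exp; split; last by rewrite coefC.
exact: size_polyC_leq1.
Qed.

(** * Restriction of Hasse derivatives to a line *)

Section Line.
Variables (K : fieldType) (n D : nat).
Implicit Types (c : {ffun 'I_n -> 'I_D} -> K) (j : 'I_n -> nat) (u v : 'I_n -> K).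

(** Evaluating [hasse] over the ring [{poly K}] lets [taylor] apply directly to the restriction. *)
Definition line_poly c j u v : {poly K} :=
  hasse (polyC \o c) j (fun i => (u i)%:P + v i *: 'X).

(** In the Taylor expansion around a parameter [t], terms of order at least [e] carry the factor
    [('X - t%:P) ^+ e], and those of lower order vanish by hypothesis. So every [t] in [r] is a root
    of multiplicity [e]. *)
Lemma line_poly_eq0 c j u v (r : seq K) (e : nat) :
  uniq r ->
  (forall t, t \in r -> forall b : 'I_n -> nat,
     (forall i, v i = 0 -> b i = 0%N) -> (\sum_i b i < e)%N ->
     hasse c (fun i => j i + b i)%N (fun i => u i + t * v i) = 0) ->
  (size (line_poly c j u v) <= size r * e)%N -> line_poly c j u v = 0.
Proof.
move=> uniq_r vanish; apply: poly_mult_roots_eq0 => // t t_r.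
have -> : line_poly c j u v =
    hasse (polyC \o c) j (fun i => (u i + t * v i)%:P + v i *: ('X - t%:P)).
  apply: hasse_ext => // i.
  by rewrite polyCD polyCM scalerBr -!mul_polyC (mulrC t%:P) addrACA subrr addr0 // addrA.
rewrite taylor; apply: (big_ind (fun p => ('X - t%:P) ^+ e %| p)) => [|p q|b _].
- exact: dvdp0.
- exact: dvdp_add.
rewrite (hasse_polyC c (fun i => j i + b i)%N (fun i => u i + t * v i)).
have [le_e|lt_e] := leqP e (\sum_i b i).
  apply: dvdp_mulr.
  have -> : \prod_i ((v i *: ('X - t%:P)) ^+ b i *+ 'C(j i + b i, j i)) =
      (\prod_i (v i ^+ b i *+ 'C(j i + b i, j i))) *: ('X - t%:P) ^+ \sum_i b i.
    rewrite -prodrXr -mul_polyC rmorph_prod -big_split /=; apply: eq_bigr => i _.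
    by rewrite exprZn polyCMn mulrnAl mul_polyC.
  by rewrite -mul_polyC; apply: dvdp_mull; apply: dvdp_exp2l.
(* Differentiating in a coordinate that is constant along the line contributes a factor 0, so only
   the [b] covered by [vanish] remain. *)
case: (pickP [pred i | (v i == 0) && (b i != 0 :> nat)]) => [i|no_i].
  case/andP=> /eqP vi0 bi0.
  by rewrite (bigD1 i) //= vi0 scale0r expr0n (negPf bi0) mul0rn !mul0r dvdp0.
rewrite vanish ?polyC0 ?mulr0 ?dvdp0 // => i /eqP vi0.
by have:= no_i i; rewrite /= vi0 => /negbFE/eqP.
Qed.

(** With [P] full, this is the derivative at the direction [v] of the homogeneous part of degree [e]
    plus the order of [j]. With [P] a single coordinate in which [j] is zero, it extracts a leading
    coefficient in that variable. *)
Lemma top_coef_line_poly c j u v (P : pred 'I_n) (e : nat) :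
  (forall i, ~~ P i -> v i = 0) ->
  (forall a, c a != 0 -> (forall i, j i <= a i)%N -> (\sum_(i | P i) (a i - j i) <= e)%N) ->
  top_coef (line_poly c j u v) e
    (hasse (fun a => if (\sum_(i | P i) (a i - j i) == e)%N then c a else 0) j
       (fun i => if P i then v i else u i)).
Proof.
move=> v0 le_e; rewrite /line_poly /hasse.
apply: (big_ind2 (fun p w => top_coef p e w)).
- by split; rewrite ?size_poly0 ?coef0.
- move=> p w q w' [sp <-] [sq <-]; split; last by rewrite coefD.
  by rewrite (leq_trans (size_polyD _ _)) // geq_max sp.
move=> a _ /=; have [->|ca0] := eqVneq (c a) 0.
  by rewrite if_same !mul0r; split; rewrite ?size_poly0 ?coef0.
case: (pickP [pred i | ~~ (j i <= a i)%N]) => [i|no_i].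
  rewrite /= -ltnNge => lt_i; rewrite !(hasse_term_eq0 _ (i := i)) // !mulr0.
  by split; rewrite ?size_poly0 ?coef0.
have {no_i}le_ja i : (j i <= a i)%N by apply: negbFE (no_i i).
have {le_e} := le_e a ca0 le_ja; have := top_coef_prod_linear u (fun i => a i - j i)%N v0.
set m := (\sum_(i | _) _)%N; set p := \prod_i _ ^+ _; set w := \prod_i _ ^+ _.
move=> [sp pm] le_m.
have binE (S : comNzRingType) (f : 'I_n -> S) :
    \prod_i (f i ^+ (a i - j i) *+ 'C(a i, j i)) =
    \prod_i (f i ^+ (a i - j i)) * (\prod_i 'C(a i, j i))%:R.
  by rewrite natr_prod -big_split; apply: eq_bigr => i _ /=; rewrite mulr_natr.
rewrite !binE -/p -/w mul_polyC (mulr_natr p) -scaler_nat scalerA (mulrC w) mulrA.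
split; first by rewrite (leq_trans (size_scale_leq _ _)) // (leq_trans sp).
rewrite coefZ; case: eqP => [<-|/eqP neq_me]; first by rewrite pm.
rewrite !mul0r nth_default ?mulr0 // (leq_trans sp) //.
by rewrite ltn_neqAle neq_me.
Qed.
End Line.

(** * Schwartz-Zippel with multiplicities for homogeneous polynomials on a grid *)

Section Grid.
Variables (K : fieldType) (k D N l d : nat).
Variables (c : {ffun 'I_k.+1 -> 'I_D} -> K) (A : 'I_k.+1 -> seq K).
Hypothesis N_gt0 : (0 < N)%N.
Hypothesis uniqA : forall i, uniq (A i).
Hypothesis sizeA : forall i, i != ord_max -> size (A i) = N.
Hypothesis A_last : A ord_max = [:: 1].
Hypothesis homog_c : forall a, c a != 0 -> (\sum_i a i = d)%N.
Hypothesis lt_d : (d < l * N)%N.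
Hypothesis vanish : forall (j : 'I_k.+1 -> nat) (x : 'I_k.+1 -> K),
  (\sum_i j i < l)%N -> (forall i, x i \in A i) -> hasse c j x = 0.

(* [t] agrees on its first [s] coordinates with the lexicographically largest
   exponent of [c], so that [hasse c j] with [j = t] on these coordinates
   computes a Hasse derivative of the iterated leading coefficient of [c]. *)
Definition lead_stage (s : nat) (t : {ffun 'I_k.+1 -> 'I_D}) : Prop :=
  [/\ c t != 0,
      forall a, c a != 0 -> (forall i : 'I_k.+1, (i < s)%N -> (t i <= a i)%N) ->
        forall i : 'I_k.+1, (i < s)%N -> a i = t i
    & forall (j : 'I_k.+1 -> nat) (x : 'I_k.+1 -> K),
        (forall i, x i \in A i) -> (forall i : 'I_k.+1, (i < s)%N -> j i = t i) ->
        j ord_max = 0%N ->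
        (\sum_(i < k.+1) (if i < s then 1 else N) * j i < l * N)%N -> hasse c j x = 0].

(** The next exponent is taken as large as possible, and a derivative is restricted to the grid line
    in that coordinate direction. It has too many zeros there, so its leading coefficient vanishes.
    In the budget [l * N], a derivative in a free coordinate costs [N], and the exponent of a fixed
    coordinate costs 1 per unit. *)
Lemma lead_stageS (s : nat) (t : {ffun 'I_k.+1 -> 'I_D}) :
  (s < k)%N -> lead_stage s t -> exists t', lead_stage s.+1 t'.
Proof.
move=> lt_sk [ct0 t_max t_van].
have [S valS] : exists S : 'I_k.+1, S = s :> nat by exists (inord s); rewrite inordK // ltnS ltnW.
have neq_Smax : S != ord_max by apply/eqP => /(congr1 val) /=; lia.
pose Q := [pred a : {ffun 'I_k.+1 -> 'I_D} |
  (c a != 0) && [forall i : 'I_k.+1, (i < s)%N ==> (a i == t i)]].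
have Qt : Q t by rewrite /= ct0; apply/forallP => i; rewrite eqxx implybT.
case: (arg_maxnP (fun a : {ffun 'I_k.+1 -> 'I_D} => a S : nat) Qt).
move=> t' /andP[/= ct'0 /forallP t't] t'_max.
have {}t't (i : 'I_k.+1) : (i < s)%N -> t' i = t i by move=> lt_is; have /implyP/(_ lt_is)/eqP := t't i.
have supp_ge a : c a != 0 -> (forall i : 'I_k.+1, (i < s)%N -> (t' i <= a i)%N) ->
    (forall i : 'I_k.+1, (i < s)%N -> a i = t' i) /\ (a S <= t' S)%N.
  move=> ca0 le_a.
  have eq_a (i : 'I_k.+1) : (i < s)%N -> a i = t i.
    apply: (t_max a ca0) => {}i lt_is; rewrite -t't //; exact: le_a.
  split=> [i lt_is|]; first by rewrite eq_a // t't.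
  apply: t'_max; rewrite /= ca0; apply/forallP => i; apply/implyP => lt_is.
  by rewrite eq_a.
have ltS (i : 'I_k.+1) : (i < s.+1)%N -> i = S \/ (i < s)%N.
  by rewrite ltnS leq_eqVlt -valS => /orP[/eqP/val_inj|]; [left|right].
exists t'; split=> //.
  move=> a ca0 le_a; have [//|eq_a le_aS] := supp_ge a ca0 _.
    by move=> i lt_is; apply: le_a; apply: ltnW.
  move=> i /ltS[->|]; last exact: eq_a.
  by apply/val_inj/anti_leq; rewrite le_aS le_a // valS.
move=> j x xA jt' jmax lt_w.
(* The derivative in direction [S] is dropped; order [t' S] in it reappears as extraction of the
   leading coefficient. *)
pose j0 (i : 'I_k.+1) := if i == S then 0%N else j i.
pose v (i : 'I_k.+1) : K := (i == S)%:R.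
pose W := (\sum_(i < k.+1 | i != S) (if i < s then 1 else N) * j i)%N.
have {lt_w} lt_w : (W + t' S < l * N)%N.
  move: lt_w; rewrite (bigD1 S) //= valS ltnSn mul1n jt' ?valS // addnC.
  congr (_ + _ < _)%N; apply: eq_bigr => i neq_iS; congr (_ * _)%N.
  have neq_is : i != s :> nat by rewrite -valS.
  by rewrite ltnS leq_eqVlt (negPf neq_is).
(* This is [(l * N - W) / N] rounded up: every order [b < e] satisfies [W + N * b < l * N], and yet
   [N * e > t' S]. *)
pose e := ((l * N - W).-1 %/ N).+1.
have v0 i : ~~ pred1 S i -> v i = 0 by rewrite /v /= => /negPf->.
have le_e a : c a != 0 -> (forall i, j0 i <= a i)%N ->
    (\sum_(i | pred1 S i) (a i - j0 i) <= t' S)%N.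
  move=> ca0 le_a; rewrite big_pred1_eq /j0 eqxx subn0.
  case: (supp_ge a ca0) => // i lt_is; rewrite -jt' ?(ltnW lt_is) //; last first.
    by rewrite ltnS ltnW.
  have := le_a i; rewrite /j0; case: eqP => // eq_iS; move: lt_is.
  by rewrite eq_iS valS ltnn.
have [le_size coef_eq] := top_coef_line_poly x v0 le_e.
have: line_poly c j0 x v = 0.
  apply: (@line_poly_eq0 _ _ _ c j0 x v [seq a - x S | a <- A S] e).
  (* The parameters [a - x S] are those where the line through [x] has its coordinate [S] in
     [A S]. *)
  - by rewrite map_inj_uniq //; apply: addIr.
  - move=> _ /mapP[y yA ->] b b0 lt_b; apply: t_van.
    + move=> i; rewrite /v; have [->|_] := eqVneq i S; last by rewrite mulr0 addr0.
      by rewrite mulr1 addrC subrK.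
    + move=> i lt_is; have neq_iS : i != S by apply/eqP => eq_iS; move: lt_is; rewrite eq_iS valS ltnn.
      rewrite /j0 (negPf neq_iS) b0 ?/v ?(negPf neq_iS) // addn0 jt' ?t't //.
      by rewrite ltnS ltnW.
    + by rewrite /j0 eq_sym (negPf neq_Smax) jmax b0 // /v eq_sym (negPf neq_Smax).
    rewrite (bigD1 S) //= /j0 eqxx valS ltnn.
    have -> : (\sum_(i < k.+1 | i != S)
        (if i < s then 1 else N) * ((if i == S then 0 else j i) + b i) = W)%N.
      by apply: eq_bigr => i neq_iS; rewrite (negPf neq_iS) b0 ?addn0 // /v (negPf neq_iS).
    move: lt_b; rewrite (bigD1 S) //= big1 ?addn0; last first.
      by move=> i neq_iS; rewrite b0 // /v (negPf neq_iS).
    rewrite add0n /e ltnS leq_divRL // => le_b.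
    by nia.
  rewrite size_map sizeA //; apply: leq_trans le_size _.
  by rewrite mulnC; apply: leq_trans (ltn_ceil _ N_gt0); nia.
move=> line0; move: coef_eq; rewrite line0 coef0 => coef_eq; rewrite [RHS]coef_eq.
apply: eq_bigr => a _; rewrite big_pred1_eq /j0 eqxx subn0.
have [->|ca0] := eqVneq (c a) 0; first by rewrite if_same !mul0r.
case: (pickP [pred i | (i != S) && (a i < j i)%N]) => [i /andP[neq_iS lt_i]|no_i].
  rewrite !(hasse_term_eq0 _ (i := i)) ?mulr0 //.
  by rewrite (negPf neq_iS).
have le_a (i : 'I_k.+1) : (i < s)%N -> (t' i <= a i)%N.
  move=> lt_is; rewrite -jt'; last by rewrite ltnS ltnW.
  have neq_iS : i != S by apply/eqP => eq_iS; move: lt_is; rewrite eq_iS valS ltnn.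
  by have := no_i i; rewrite /= neq_iS /= ltnNge => /negbFE.
have [_ le_aS] := supp_ge a ca0 le_a.
rewrite !(bigD1 S (P := xpredT)) //= eqxx /v jt' ?valS // eqxx subn0 bin0 expr1n mulr1n mul1r.
(* As [j S = t' S], exponents with [a S < t' S] have a zero binomial; the others are those selected
   by the top coefficient. *)
case: eqP => [->|/eqP neq_aS]; last first.
  by rewrite bin_small ?mulr0n ?mul0r ?mulr0 // ltn_neqAle neq_aS.
rewrite subnn binn expr0 mulr1n mul1r; congr (_ * _); apply: eq_bigr => i neq_iS.
by rewrite (negPf neq_iS).
Qed.

(** After [k] stages only the last exponent is free, and homogeneity determines it. Since the last
    coordinate is 1, the Hasse derivative then equals the single coefficient [c t]. *)
Lemma homog_grid_eq0 a : c a = 0.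
Proof.
apply/eqP; apply/negPn/negP => ca0.
have lead_stage_exists s : (s <= k)%N -> exists t, lead_stage s t.
  elim: s => [_|s IHs lt_sk]; last first.
    by have [t /(lead_stageS lt_sk)] := IHs (ltnW lt_sk).
  (* At stage 0 every weight is [N], so the budget says that [j] has order less than [l]. *)
  exists a; split=> // j x xA _ _ lt_w; apply: vanish => //.
  by move: lt_w; rewrite -big_distrr /= mulnC ltn_mul2r => /andP[].
have [t [ct0 t_max t_van]] := lead_stage_exists k (leqnn k).
pose j (i : 'I_k.+1) := if (i < k)%N then t i : nat else 0%N.
pose x i := nth 0 (A i) 0.
have xA i : x i \in A i.
  apply: mem_nth; have [->|neq_i] := eqVneq i ord_max; first by rewrite A_last.
  by rewrite sizeA.
have maxE (i : 'I_k.+1) : (i < k)%N = (i != ord_max).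
  by rewrite ltn_neqAle -ltnS ltn_ord andbT.
have hasse0 : hasse c j x = 0.
  (* At stage [k] this [j] has weight at most the degree [d], which is below [l * N]. *)
  apply: t_van => // [i lt_i||]; rewrite /j ?lt_i ?ltnn //.
  apply: leq_ltn_trans lt_d; rewrite -(homog_c ct0); apply: leq_sum => i _.
  by case: ifP => _; rewrite ?mul1n ?muln0.
case/eqP: (ct0); rewrite -[RHS]hasse0.
rewrite /hasse (bigD1 t) //= [X in _ = _ + X]big1 ?addr0 => [|b neq_bt].
  rewrite big1 ?mulr1 // => i _; rewrite /j maxE; case: eqVneq => [->|_] /=.
    by rewrite /x A_last expr1n bin0.
  by rewrite subnn binn expr0.
have [->|cb0] := eqVneq (c b) 0; first by rewrite mul0r.
case: (pickP [pred i | (b i < j i)%N]) => [i lt_i|no_i].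
  by rewrite (hasse_term_eq0 _ (i := i)) ?mulr0.
have eq_b : forall i : 'I_k.+1, (i < k)%N -> b i = t i.
  apply: (t_max b cb0) => i lt_i.
  by have:= no_i i; rewrite /= /j lt_i ltnNge => /negbFE.
case/eqP: neq_bt; apply/ffunP => i; have [lt_i|] := boolP (i < k)%N; first exact: eq_b.
rewrite maxE negbK => /eqP->; apply: val_inj.
have := homog_c cb0; rewrite -(homog_c ct0) (bigD1 ord_max) //= [RHS](bigD1 ord_max) //=.
have -> : (\sum_(i < k.+1 | i != ord_max) b i = \sum_(i < k.+1 | i != ord_max) t i)%N.
  by apply: eq_bigr => i'; rewrite -maxE => /eq_b->.
by move/addIn.
Qed.
End Grid.

(** * Dimension count and the inequality for fixed [l] *)

Lemma exists_nontrivial_solution (K : fieldType) (I J : finType) (F : I -> J -> K) :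
  (#|J| < #|I|)%N ->
  exists w : I -> K, (exists i, w i != 0) /\ forall j, \sum_i w i * F i j = 0.
Proof.
move=> lt_JI; pose M : 'M[K]_(#|I|, #|J|) := \matrix_(p, q) F (enum_val p) (enum_val q).
have : kermx M != 0.
  by rewrite kermx_eq0 /row_free neq_ltn (leq_ltn_trans (rank_leq_col M)).
case/rowV0Pn => v; rewrite sub_kermx => /eqP vM v_neq0.
exists (fun i => v 0 (enum_rank i)); split.
  by have [p vp] := rV0Pn _ v_neq0; exists (enum_val p); rewrite enum_valK.
move=> j; have := congr1 (fun A : 'rV_#|J| => A 0 (enum_rank j)) vM.
rewrite !mxE => {2}<-; rewrite (reindex _ (onW_bij _ (@enum_val_bij I))) /=.
by apply: eq_bigr => p _; rewrite !mxE enum_valK enum_rankK.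
Qed.

Definition exponents (n d : nat) := [set f : {ffun 'I_n -> 'I_d.+1} | (\sum_i f i <= d)%N].

Lemma card_exponents (n d : nat) : #|exponents n d| = 'C(n + d, n).
Proof.
rewrite -card_partial_ord_partitions.
pose f (t : n.-tuple 'I_d.+1) := [ffun i => tnth t i].
rewrite -(@on_card_preimset _ _ f).
  apply: eq_card => t; rewrite !inE big_tuple; congr (_ <= _)%N.
  by apply: eq_bigr => i _; rewrite ffunE.
apply: onW_bij; exists (fun g : {ffun 'I_n -> 'I_d.+1} => [tuple g i | i < n]) => [t|g].
  by apply: eq_from_tnth => i; rewrite tnth_mktuple ffunE.
by apply/ffunP => i; rewrite ffunE tnth_mktuple.
Qed.

Lemma exists_vanishing_poly (K : fieldType) (n d m : nat) (s : seq 'rV[K]_n) :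
  (size s * 'C(n + m, n) < 'C(n + d, n))%N ->
  exists c : {ffun 'I_n -> 'I_d.+1} -> K,
    [/\ exists a, c a != 0, forall a, c a != 0 -> (\sum_i a i <= d)%N
      & forall (y : 'rV[K]_n) (j : 'I_n -> nat), y \in s -> (\sum_i j i <= m)%N ->
          hasse c j (y 0) = 0].
Proof.
move=> lt_card.
(* The unknowns are all coefficients in the box of exponents at most [d]. Besides the vanishing
   conditions, the right summand imposes [c b = 0] for every [b] of total degree above [d]. *)
pose F (a : {ffun 'I_n -> 'I_d.+1})
    (e : 'I_(size s) * {j | j \in exponents n m} + {b | b \in ~: exponents n d}) : K :=
  match e with
  | inl (p, j) => \prod_i (s`_p 0 i ^+ (a i - val j i) *+ 'C(a i, val j i))
  | inr b => (a == val b)%:R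
  end.
have [|c [c_neq0 cF]] := @exists_nontrivial_solution K _ _ F.
  rewrite card_sum card_prod card_ord !card_sig -[X in (_ < X)%N](cardC [in exponents n d]).
  rewrite !card_exponents (@eq_card _ _ [predC exponents n d]) ?ltn_add2r //.
  by move=> a; rewrite !inE.
exists c; split=> // [a|y j y_s le_j].
  apply: contraR => notE_a.
  have aE : a \in ~: exponents n d by rewrite !inE.
  have := cF (inr (exist _ a aE)); rewrite (bigD1 a) //= eqxx mulr1 big1 ?addr0 => [->//|b].
  by move=> /negPf->; rewrite mulr0.
have lt_j i : (j i < m.+1)%N.
  by rewrite ltnS; apply: leq_trans le_j; rewrite (bigD1 i) //= leq_addr.
pose g : {ffun 'I_n -> 'I_m.+1} := [ffun i => Ordinal (lt_j i)].
have gE : g \in exponents n m.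
  by rewrite inE (eq_bigr j) // => i _; rewrite ffunE.
have lt_y : (index y s < size s)%N by rewrite index_mem.
rewrite -(cF (inl (Ordinal lt_y, exist _ g gE))); apply: eq_bigr => a _ /=.
by congr (_ * _); apply: eq_bigr => i _; rewrite nth_index // ffunE.
Qed.

(* [m = 2 l - 2] and [d = l N - 1]: for [|j| < l] the restriction to a rich line
   has degree at most [l N - 1 - |j| < N (2 l - 1 - |j|)]. *)
Lemma rich_grid_bin_leq (K : fieldType) (k N l : nat) (A : 'I_k.+1 -> seq K)
    (s : seq 'rV[K]_k.+1) :
  (0 < N)%N -> (0 < l)%N ->
  (forall i, uniq (A i)) -> (forall i, i != ord_max -> size (A i) = N) ->
  A ord_max = [:: 1] ->
  (forall v : 'rV[K]_k.+1, (forall i, v 0 i \in A i) ->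
     exists (u : 'rV[K]_k.+1) (r : seq K),
       [/\ uniq r, (N <= size r)%N & forall t, t \in r -> u + t *: v \in s]) ->
  ('C(k.+1 + (l * N).-1, k.+1) <= size s * 'C(k.+1 + (l.-1).*2, k.+1))%N.
Proof.
move=> N_gt0 l_gt0 uniqA sizeA A_last rich; rewrite leqNgt; apply/negP.
set d := (l * N).-1 => /exists_vanishing_poly[c [[a0 ca0] le_d vanish]].
(* The actual degree [e] of the polynomial is attained at [a1]; its top-degree part [h] will be
   shown to be zero. *)
case: (arg_maxnP (P := fun a => c a != 0) (fun a : {ffun 'I_k.+1 -> 'I_d.+1} => (\sum_i a i)%N) ca0).
move=> a1 ca1 deg_max; set e := (\sum_i a1 i)%N in deg_max.
have lt_e : (e < l * N)%N.
  by apply: leq_ltn_trans (le_d _ ca1) _; rewrite prednK // muln_gt0 l_gt0.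
pose h (a : {ffun 'I_k.+1 -> 'I_d.+1}) := if (\sum_i a i == e)%N then c a else 0.
suff: h a1 = 0 by rewrite /h eqxx => /eqP; apply/negP.
apply: (@homog_grid_eq0 K k d.+1 N l e h A) => //.
  by move=> a; rewrite /h; case: (_ =P e) => // _; rewrite eqxx.
move=> j x lt_j xA; pose v : 'rV[K]_k.+1 := \row_i x i.
have [|u [r [uniq_r le_r r_s]]] := rich v; first by move=> i; rewrite mxE.
(* If [j] has order above [e], no exponent of degree [e] dominates it; this case is separate because
   [e - \sum_i j i] is truncated. *)
have [lt_ej|le_je] := ltnP e (\sum_i j i).
  rewrite /hasse big1 // => a _; rewrite /h; case: eqP => [def_e|_]; last by rewrite mul0r.
  case: (pickP [pred i | (a i < j i)%N]) => [i lt_i|no_i].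
    by rewrite (hasse_term_eq0 _ (i := i)) ?mulr0.
  move: lt_ej; rewrite -def_e ltnNge => /negP[]; apply: leq_sum => i _.
  by rewrite leqNgt; apply/negbT/no_i.
pose P := @predT 'I_k.+1.
have subE (a : {ffun 'I_k.+1 -> 'I_d.+1}) : (forall i, j i <= a i)%N ->
    (\sum_(i | P i) (a i - j i) = \sum_i a i - \sum_i j i)%N.
  move=> le_ja; apply/eqP; rewrite -(eqn_add2r (\sum_i j i)) subnK ?leq_sum //.
  by rewrite -big_split /=; apply/eqP; apply: eq_bigr => i _; rewrite subnK.
have [|| le_size coef_eq] := @top_coef_line_poly _ _ _ c j (u 0) x P (e - \sum_i j i).
- by [].
- by move=> a ca le_ja; rewrite subE // leq_sub2r //; apply: deg_max.
have line0 : line_poly c j (u 0) x = 0.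
  apply: (@line_poly_eq0 _ _ _ c j (u 0) x r (l.*2.-1 - \sum_i j i)) => //.
    move=> t /r_s y_s b _ lt_b; rewrite -(vanish _ (fun i => j i + b i)%N y_s).
      by apply: hasse_ext => // i; rewrite !mxE.
    by rewrite big_split -ltnS; move: lt_b; rewrite ltn_subRL => /leq_trans; apply; lia.
  apply: leq_trans le_size _.
  apply: (@leq_trans (N * (l.*2.-1 - \sum_i j i))); last by rewrite leq_mul2r le_r orbT.
  (* From [J < l] follows [2 l - 1 - J >= l], so the right side is at least [l * N], which exceeds
     [e]. *)
  by move: lt_j le_je; move: (\sum_i j i)%N => J; nia.
move: coef_eq; rewrite line0 coef0 => coef_eq; rewrite [RHS]coef_eq.
apply: eq_bigr => a _; rewrite /h /=.
case: (pickP [pred i | (a i < j i)%N]) => [i lt_i|no_i].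
  by rewrite !(hasse_term_eq0 _ (i := i)) ?mulr0.
have le_ja i : (j i <= a i)%N by rewrite leqNgt; apply/negbT/no_i.
rewrite subE //; congr (_ * _); congr (if _ then _ else _).
by rewrite -[RHS](eqn_add2r (\sum_i j i)) !subnK //; apply: leq_sum => i _; apply: le_ja.
Qed.

(** * Passing to large [l] *)

(** The excess over the leading term is of lower order in [M]; [4 ^ k.+1] is a crude constant that
    closes the induction. *)
Lemma expn_double_succ_leq (k M : nat) : (0 < M)%N ->
  ((M.*2.+1) ^ k.+1 <= M.*2 ^ k.+1 + 4 ^ k.+1 * M ^ k)%N.
Proof.
move=> M_gt0; elim: k => [|k IHk]; first by rewrite !expn1 expn0; lia.
rewrite expnS; apply: leq_trans (leq_mul (leqnn _) IHk) _.
rewrite -!muln2 !expnMn in IHk *; rewrite ![(_ ^ k.+2)%N]expnS ![(M ^ k.+1)%N]expnS.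
have : (2 ^ k.+1 <= 4 ^ k.+1)%N by rewrite leq_exp2r.
move: (2 ^ k.+1)%N (4 ^ k.+1)%N (M ^ k)%N => a b c le_ab.
have : (M * a * c <= M * b * c)%N by rewrite leq_mul2r leq_mul2l le_ab !orbT.
have : (b * c <= M * b * c)%N by rewrite leq_mul2r leq_pmull ?orbT.
nia.
Qed.

(** Up to the common factor [n!], the binomials grow like [(l N)^n] and [(2 l)^n]. A single large
    [l] replaces the limit. *)
Lemma bin_leq_limit (k N S : nat) : (0 < N)%N ->
  (forall l, 0 < l -> 'C(k.+1 + (l * N).-1, k.+1) <= S * 'C(k.+1 + (l.-1).*2, k.+1))%N ->
  (N ^ k.+1 <= S * 2 ^ k.+1)%N.
Proof.
move=> N_gt0 bound; set n := k.+1 in bound *; rewrite leqNgt; apply/negP => lt_SN.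
have ratio l : (0 < l)%N -> ((l * N) ^ n <= S * (n + l.*2) ^ n)%N.
  move=> l_gt0; have lN_gt0 : (0 < l * N)%N by rewrite muln_gt0 l_gt0.
  have ffact_geq m : (m.+1 ^ n <= (n + m) ^_ n)%N.
    rewrite ffact_prod -[n in X in (X <= _)%N]card_ord -prod_nat_const leq_prod // => i _.
    by have := ltn_ord i; lia.
  have ffact_leq m : (m ^_ n <= m ^ n)%N.
    rewrite ffact_prod -[n in X in (_ <= X)%N]card_ord -prod_nat_const leq_prod // => i _.
    exact: leq_subr.
  have := ffact_geq (l * N).-1; rewrite prednK // => /leq_trans; apply.
  rewrite -bin_ffact; apply: leq_trans (leq_mul (bound l l_gt0) (leqnn _)) _.
  rewrite -mulnA bin_ffact leq_mul2l; apply/orP; right.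
  by apply: leq_trans (ffact_leq _) _; rewrite leq_exp2r // leq_add2l; lia.
(* With [l = n * M], [n + 2 l = n * (2 M + 1)] and [n ^ n] cancels. A gap of 1 between [S * 2 ^ n]
   and [N ^ n] yields [M ^ n = M * M ^ k], which exceeds the error [S * 4 ^ n * M ^ k]. *)
pose M := (S * 4 ^ n).+1.
have := ratio (n * M)%N isT.
rewrite doubleMr -mulnS -mulnA !(expnMn n) mulnCA leq_pmul2l ?expn_gt0 // expnMn.
have := expn_double_succ_leq k (ltn0Sn (S * 4 ^ n)); rewrite -/M -/n => le_M le_MN.
have {le_M} := leq_trans le_MN (leq_mul (leqnn S) le_M).
apply/negP; rewrite -ltnNge -muln2 expnMn mulnDr mulnCA.
apply: (@leq_trans (M ^ n * (S * 2 ^ n).+1)); last by rewrite leq_mul2l lt_SN orbT.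
rewrite mulnS addnC ltn_add2r mulnA [X in (_ < X)%N]expnS ltn_pmul2r ?ltnSn //.
by rewrite expn_gt0.
Qed.

Theorem theorem3p4 (K : fieldType) (n N : nat) (hn : (2 <= n)%N) (hN : (0 < N)%N)
  (L : 'rV[K]_n -> 'rV[K]_n -> Prop) (hL : forall u v, L u v -> v != 0)
  (S : 'rV[K]_n -> Prop)
  (hS : forall u v, L u v -> exists s : seq 'rV[K]_n,
          [/\ uniq s, (N <= size s)%N & forall x, x \in s -> S x /\ on_line u v x])
  (hD : contains_grid N (directions L)) :
  forall s : seq 'rV[K]_n, uniq s -> (forall x, S x <-> x \in s) ->
    ((N%:R / 2 : rat) ^+ n <= (size s)%:R).
Proof.
move=> s _ sS; case: n hn L hL S hS hD s sS => [//|k] _ L _ S hS [B [A0 [Bu [A0P gridD]]]] s sS.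
rewrite expr_div_n ler_pdivrMr ?exprn_gt0 // -!natrX -natrM ler_nat.
apply: bin_leq_limit => // l l_gt0.
pose A (i : 'I_k.+1) : seq K := oapp A0 [:: 1] (insub (val i)).
(* Multiplying by the inverse of [B] puts the grid in standard position, with [A] equal to [[:: 1]]
   in the last coordinate. *)
rewrite -(size_map (mulmx^~ (invmx B)) s).
apply: (@rich_grid_bin_leq K k N l A) => //.
- by move=> i; rewrite /A; case: insub => //= j; case: (A0P j).
- move=> i neq_i; rewrite /A; case: insubP => /= [j _ _|]; first by case: (A0P j).
  rewrite -leqNgt leqNgt; case/negP; rewrite ltn_neqAle -ltnS ltn_ord andbT.
  by apply: contra neq_i => /eqP eq_i; apply/eqP/val_inj.
- by rewrite /A insubF //= ltnn.
move=> v vA; pose a (j : 'I_k) := v 0 (widen_ord (leqnSn k) j).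
have aA j : a j \in A0 j.
  have := vA (widen_ord (leqnSn k) j); rewrite /A; case: insubP => [j' _ eq_j|]; last first.
    by rewrite /= ltn_ord.
  by rewrite /= (_ : j' = j) //; apply: val_inj.
have vE : @grid_vec K k.+1 a = v.
  apply/rowP => i; rewrite mxE; case: insubP => [j _ eq_j|ge_i] /=.
    by congr (v _ _); apply: val_inj.
  have := vA i; rewrite /A insubN //= inE => /eqP->//.
have v_last : v 0 ord_max = 1.
  by have := vA ord_max; rewrite /A insubF /= ?ltnn // inE => /eqP.
have [u [w [Luw [c [c_neq0 wE]]]]] := gridD a aA.
have [t [uniq_t le_t tP]] := hS u w Luw.
(* The last coordinate of [v] is 1, so the last coordinate of the displacement from [u'] is the
   parameter on the transformed line. *)
pose u' := u *m invmx B; pose coord x := (x *m invmx B - u') 0 ord_max.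
have coordE x : x \in t -> x *m invmx B = u' + coord x *: v.
  case/tP => _ [lam def_x].
  have xE : x *m invmx B = u' + (lam * c) *: v.
    by rewrite def_x mulmxDl wE vE -!scalemxAl mulmxK // scalerA.
  by rewrite /coord xE [u' + _]addrC addrK mxE v_last mulr1 addrC.
exists u', [seq coord x | x <- t]; split.
- rewrite map_inj_in_uniq // => x y xt yt eq_xy.
  by apply: (can_inj (mulmxKV Bu)); rewrite !coordE // eq_xy.
- by rewrite size_map.
move=> _ /mapP[x xt ->]; rewrite -coordE //; apply/mapP.
by exists x => //; apply/sS; case: (tP x xt).
Qed.
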